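(* Let $p$ be a prime, let $c, d, f \ge 1$ be integers, let $U$ be a finite $p$-group of nilpotency class at most $c$, and let $e = \lceil c \log_p d \rceil$. If there is a surjective homomorphism $U \to C_{p^{2f+e+1}}^d$, then $U$ has a subgroup isomorphic to $C_{p^f}^d$.
   Context: $C_k$ denotes the cyclic group of order $k$ and $C_k^d$ the direct product of $d$ copies of $C_k$. *)

(* Defs.v *)
From HB Require Import structures.
From mathcomp Require Import all_boot all_order all_algebra all_fingroup all_solvable.
From mathcomp Require Import reals exp.

Set Implicit Arguments.
Unset Strict Implicit.
Unset Printing Implicit Defensive.

Import GroupScope.

(* C_k^d for k >= 1.  The factor is [Zp k] rather than the whole type 'Z_k,
   which has two elements when k = 1. *)
Definition Cpow (k d : nat) : {group {dffun forall _ : 'I_d, 'Z_k}} :=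
  setXn_group (fun _ : 'I_d => Zp_group k).

Definition logb (R : realType) (b x : R) : R := (ln x / ln b)%R.

Lemma card_Cpow (k d : nat) : 0 < k -> #|Cpow k d| = (k ^ d)%N.
Proof.
move=> k_gt0; rewrite /Cpow /= cardsXn.
under eq_bigr do rewrite card_Zp //.
by rewrite prod_nat_const card_ord.
Qed.

(* Main.v *)
Require Import Defs.
From HB Require Import structures.
From mathcomp Require Import all_boot all_order all_algebra all_fingroup all_solvable.
From mathcomp Require Import reals exp.
From mathcomp Require Import zify.

Set Implicit Arguments.
Unset Strict Implicit.
Unset Printing Implicit Defensive.

Import GroupScope.

(* Model: in a finite Lie ring L, if p^f z = 0 then [z, p^f x] = [p^f z, x] = 0,
   so the elements of M = p^f L killed by p^f are central in M.

   In a p-group U of class c, the Hall-Petrescu formula yields the same up to a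
   loss of about c / (p - 1) in the exponent, which e = ceil (c log_p d) covers
   when d >= 2 because p <= 2 ^ (p - 1).  With M the subgroup generated by the
   p^(f+e+1)-th powers, elements z of M with z^(p^(f+1)) = 1 are central in M.
   This forces x^-1 y to be killed by p^f as soon as x^p and y^p differ by an
   element killed by p^(f-1), so counting p-th powers in M shows that
   |Ohm_f(Z(M)) : Ohm_(f-1)(Z(M))| is at least the number p^d of
   p^(f-1)-th powers in the image C_(p^f)^d of M, and the structure of the
   abelian group Z(M) finishes.  The case d = 1 is the same argument inside a
   cyclic subgroup of U. *)

(** * Polynomial sequences in filtered groups and the Hall-Petrescu formula *)

Lemma commgM_diff (gT : finGroupType) (x y a b : gT) :
  [~ x, y]^-1 * [~ x * a, y * b] =
  ([~ x, b] ^ a * [~ a, b]) ^ [~ x, y]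
    * ([~ [~ x, y], b] * [~ [~ x, y], a] ^ b) * [~ a, y] ^ b.
Proof.
rewrite -commgMJ (commgMJ (x * a)) (commMgJ x a b) (commMgJ x a y).
rewrite (conjMg _ [~ a, y]) -(conjgM [~ x, y]).
rewrite [[~ x, y, a * b]]commgEl.
move: [~ x, y] ([~ x, b] ^ a * _) (_ ^ b) => u v w.
by rewrite [v ^ u]conjgE !mulgA mulgK.
Qed.

Section PolynomialSequences.

Variables (gT : finGroupType) (G : nat -> {group gT}).
Hypothesis G_comm : forall i j, [~: G i, G j] \subset G (i + j).
Hypothesis G_decr : forall i, G i.+1 \subset G i.

Implicit Types u v : nat -> gT.

(** The polynomial sequences of Lazard and Leibman, for the filtration shifted by [i], are those
    satisfying this for every [k]; stopping after [k] differences makes the recursion structural. *)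
Fixpoint is_polyseq k i u : Prop :=
  if k is k'.+1 then
    (forall n, u n \in G i) /\ is_polyseq k' i.+1 (fun n => (u n)^-1 * u n.+1)
  else True.

Lemma eq_polyseq k i u v : u =1 v -> is_polyseq k i u -> is_polyseq k i v.
Proof.
elim: k i u v => //= k IHk i u v eq_uv [Gu Pu]; split=> [n|]; first by rewrite -eq_uv.
by apply: IHk Pu => n; rewrite !eq_uv.
Qed.

Lemma polyseq_trunc k i u : is_polyseq k.+1 i u -> is_polyseq k i u.
Proof. by elim: k i u => // k IHk i u [Gu Pu]; split; last exact: IHk. Qed.

Lemma polyseq_le k i j u : i <= j -> is_polyseq k j u -> is_polyseq k i u.
Proof.
elim: k i j u => //= k IHk i j u le_ij [Gu Pu]; split=> [n|]; last exact: IHk Pu.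
move: (Gu n); rewrite -(subnK le_ij); elim: (j - i) => // m IHm /(subsetP (G_decr _)).
exact: IHm.
Qed.

(* Lazard-Leibman: polynomial sequences form a filtered group.  Truncating
   after k differences makes the three closure properties a joint induction
   on k. *)
Lemma polyseq_group k :
  [/\ forall i u v, is_polyseq k i u -> is_polyseq k i v ->
        is_polyseq k i (fun n => u n * v n),
      forall i u, is_polyseq k i u -> is_polyseq k i (fun n => (u n)^-1) &
      forall i j u v, is_polyseq k i u -> is_polyseq k j v ->
        is_polyseq k (i + j) (fun n => [~ u n, v n])].
Proof.
elim: k => [|k [IHM IHV IHR]]; first by split.
have conj i j u v : is_polyseq k i u -> is_polyseq k j v ->
    is_polyseq k i (fun n => u n ^ v n).
  move=> Pu Pv; apply: (@eq_polyseq _ _ (fun n => u n * [~ u n, v n])) => [n|].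
    by rewrite conjg_mulR.
  by apply: IHM => //; apply: polyseq_le (IHR _ _ _ _ Pu Pv); rewrite leq_addr.
split.
- move=> i u v Pu Pv; have [[Gu Du] [Gv Dv]] := (Pu, Pv).
  split=> [n|]; first by rewrite groupM.
  apply: (@eq_polyseq _ _ (fun n => ((u n)^-1 * u n.+1) ^ v n * ((v n)^-1 * v n.+1))).
    by move=> n; rewrite conjgE !invMg ?invgK !mulgA !(mulgK, mulgKV).
  by apply: IHM => //; apply: conj Du (polyseq_trunc Pv).
- move=> i u Pu; have [Gu Du] := Pu; split=> [n|]; first by rewrite groupV.
  apply: (@eq_polyseq _ _ (fun n => ((u n)^-1 * u n.+1)^-1 ^ (u n)^-1)).
    by move=> n; rewrite conjgE !invMg ?invgK !mulgA !(mulgK, mulgKV).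
  exact: conj (IHV _ _ Du) (IHV _ _ (polyseq_trunc Pu)).
- move=> i j u v Pu Pv; have [[Gu Du] [Gv Dv]] := (Pu, Pv).
  split=> [n|]; first by rewrite (subsetP (G_comm _ _)) ?mem_commg.
  set a := fun n => (u n)^-1 * u n.+1 in Du; set b := fun n => (v n)^-1 * v n.+1 in Dv.
  move: Pu Pv => /polyseq_trunc Pu /polyseq_trunc Pv.
  have Puv := IHR _ _ _ _ Pu Pv.
  have Pub : is_polyseq k (i + j).+1 (fun n => [~ u n, b n]) by rewrite -addnS; apply: IHR.
  have Pav : is_polyseq k (i + j).+1 (fun n => [~ a n, v n]) by rewrite -addSn; apply: IHR.
  have Pab : is_polyseq k (i + j).+1 (fun n => [~ a n, b n]).
    by apply: polyseq_le (IHR _ _ _ _ Du Dv); rewrite addSn addnS.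
  have Pw w l : 0 < l -> is_polyseq k l w ->
      is_polyseq k (i + j).+1 (fun n => [~ [~ u n, v n], w n]).
    by move=> l0 Pw; apply: polyseq_le (IHR _ _ _ _ Puv Pw); rewrite -addn1 leq_add2l.
  (* By [commgM_diff] the difference of [u, v] is a product of factors that each involve an
     increment [a] or [b], hence have degree at least i + j + 1. *)
  apply: (@eq_polyseq _ _ (fun n => ([~ u n, b n] ^ a n * [~ a n, b n]) ^ [~ u n, v n]
      * ([~ [~ u n, v n], b n] * [~ [~ u n, v n], a n] ^ b n) * [~ a n, v n] ^ b n)).
    move=> n; have [-> ->] : u n.+1 = u n * a n /\ v n.+1 = v n * b n by rewrite !mulKVg.
    by rewrite commgM_diff.
  apply: (IHM) (IHM _ _ _ _ _) _; last exact: conj Pav Dv.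
    exact: conj (IHM _ _ _ (conj _ _ _ _ Pub Du) Pab) Puv.
  by apply: IHM; [apply: Pw Dv | apply: conj (Pw _ _ _ Du) Dv].
Qed.

(** By Pascal's rule each difference lowers [s] by one, until the sequence becomes constant. *)
Lemma polyseq_binom k i s g : g \in G (i + s) -> is_polyseq k i (fun n => g ^+ 'C(n, s)).
Proof.
elim: k i s g => // k IHk i s g Gg; split=> [n|].
  rewrite groupX //; move: Gg; elim: s => [|s IHs]; first by rewrite addn0.
  by rewrite addnS => /(subsetP (G_decr _)).
case: s Gg => [|s] Gg.
  apply: (@eq_polyseq _ _ (fun n => 1 ^+ 'C(n, 0))) => [n|].
    by rewrite !bin0 mulVg.
  by apply: IHk; rewrite group1.
apply: (@eq_polyseq _ _ (fun n => g ^+ 'C(n, s))) => [n|].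
  by rewrite binS expgD mulKg.
by apply: IHk; rewrite addSnnS.
Qed.

(** Since the earlier values are trivial, u(m) is the m-th iterated difference of u at 0. *)
Lemma polyseq_first u m i : is_polyseq m.+1 i u -> (forall n, n < m -> u n = 1) ->
  u m \in G (i + m).
Proof.
elim: m i u => [|m IHm] i u [Gu Du] u1; first by rewrite addn0.
rewrite -addSnnS -[u _]mul1g -{1}invg1 -(u1 m) //.
by apply: IHm Du _ => n ltnm; rewrite !u1 ?mulVg // ltnW.
Qed.

(** Discrete Taylor expansion: dividing u by the polynomial sequence [u m ^+ 'C(i, m)] makes it
    vanish at m as well, and the induction proceeds on n + 1 - m. *)
Lemma polyseq_taylor (K : {group gT}) n m u :
    (forall k, is_polyseq k 0 u) -> (forall i, i < m -> u i = 1) ->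
    (forall s c, m <= s <= n -> c \in G s -> c ^+ 'C(n, s) \in K) ->
  u n \in K.
Proof.
have [d] := ubnP (n.+1 - m); elim: d m u => // d IHd m u.
rewrite ltnS => le_d Pu u1 KC; have [le_mn | /u1->] := leqP m n; last exact: group1.
have Gum : u m \in G m by apply: (@polyseq_first u m 0).
rewrite -(mulKVg (u m ^+ 'C(n, m)) (u n)) groupM ?KC ?le_mn ?leqnn //.
apply: (IHd m.+1 (fun i => (u m ^+ 'C(i, m))^-1 * u i)).
- by rewrite subSS -subSn.
- move=> k; have [IHM IHV _] := polyseq_group k.
  by apply: IHM => //; apply: IHV; apply: polyseq_binom.
- move=> i; rewrite ltnS leq_eqVlt => /predU1P[->|lt_im]; first by rewrite binn mulVg.
  by rewrite (u1 i) // bin_small // mulg1 invg1.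
by move=> s c /andP[lt_ms le_sn]; apply: KC; rewrite ltnW.
Qed.

(** The quotient, as a sequence in n, is polynomial and trivial at 0 and 1, so its Taylor expansion
    starts at s = 2. *)
Lemma Hall_Petrescu (K : {group gT}) x y n : x \in G 1%N -> y \in G 1%N ->
    (forall s c, 1 < s <= n -> c \in G s -> c ^+ 'C(n, s) \in K) ->
  (x ^+ n * y ^+ n)^-1 * (x * y) ^+ n \in K.
Proof.
move=> Gx Gy; pose u i := (x ^+ i * y ^+ i)^-1 * (x * y) ^+ i.
apply: (@polyseq_taylor K n 2 u) => [k | [|[|]] // _]; last 2 first.
- by rewrite /u !expg0 !mulg1 invg1.
- by rewrite /u !expg1 mulVg.
have [IHM IHV _] := polyseq_group k.
have Pexp g : g \in G 1%N -> is_polyseq k 0 (fun i => g ^+ i).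
  move=> Gg; apply: (@eq_polyseq _ _ (fun i => g ^+ 'C(i, 1))) => [i|]; first by rewrite bin1.
  exact: polyseq_binom.
apply: (IHM 0 (fun i => (x ^+ i * y ^+ i)^-1)); last by apply: Pexp; rewrite groupM.
by apply: IHV; apply: IHM; apply: Pexp.
Qed.

End PolynomialSequences.

(** * Divisibility of binomial coefficients by powers of p *)

Lemma ltn_mul_predn_expn p v : 0 < p -> v * p.-1 < p ^ v.
Proof.
case: p => //= p _; elim: v => // v IHv; rewrite expnS !mulSn addnC -addSn.
by rewrite leq_add // leq_pmulr // expn_gt0.
Qed.

(** Let v be the valuation of s. The identity s C(p^r, s) = p^r C(p^r - 1, s - 1) loses at most v
    factors p, and v (p - 1) < p^v <= s. *)
Lemma pfactor_dvd_bin p r s : prime p -> 0 < s <= p ^ r ->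
  exists2 t, p ^ t %| 'C(p ^ r, s) & r * p.-1 <= t * p.-1 + s.-1.
Proof.
move=> p_pr /andP[s_gt0 le_s]; have p_gt0 := prime_gt0 p_pr.
have C_gt0 : 0 < 'C(p ^ r, s) by rewrite bin_gt0.
exists (r - logn p s).
  rewrite pfactor_dvdn // leq_subLR -lognM // -pfactor_dvdn ?muln_gt0 ?s_gt0 //.
  by rewrite -[s]prednK // -mul_bin_diag dvdn_mulr.
have lt_s : logn p s * p.-1 < s.
  by rewrite (leq_trans (ltn_mul_predn_expn _ _)) // dvdn_leq // pfactor_dvdnn.
by rewrite mulnBl; lia.
Qed.

(** * The series N, [N, U], [N, U, U], ... and powers of its elements *)

Lemma three_subgroup_mod (gT : finGroupType) (G H K N : {group gT}) :
    G \subset 'N(N) -> H \subset 'N(N) -> K \subset 'N(N) ->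
    [~: G, H, K] \subset N -> [~: H, K, G] \subset N ->
  [~: K, G, H] \subset N.
Proof.
move=> nNG nNH nNK sGHK sHKG; have nNR := comm_subG.
rewrite -quotient_sub1; last by rewrite !nNR.
have Req (A B C : {group gT}) : A \subset 'N(N) -> B \subset 'N(N) -> C \subset 'N(N) ->
    [~: A, B, C] / N = [~: A / N, B / N, C / N].
  by move=> nNA nNB nNC; rewrite !quotientR ?nNR.
rewrite Req //; apply/trivgP; apply: (@three_subgroup _ (G / N)%G (H / N)%G (K / N)%G).
  by rewrite /= -Req // quotientS1.
by rewrite /= -Req // quotientS1.
Qed.

Section RelativeSeries.

Variables (gT : finGroupType) (U N : {group gT}).
Hypothesis nsNU : N <| U.

(** In the application N is the normal closure of an element z, so the order of z controls the
    exponents of all terms. The index counts commutations with U, one less than in the lower central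
    series. *)
Fixpoint rel_lcn i : {group gT} :=
  if i is i'.+1 then [~: rel_lcn i', U]%G else N.

Lemma rel_lcn_normal i : rel_lcn i <| U.
Proof.
elim: i => //= i /andP[sVU nVU]; rewrite /normal normsR ?normG // andbT.
by apply: subset_trans sVU; rewrite commg_subl.
Qed.

Lemma rel_lcn_norm i : U \subset 'N(rel_lcn i).
Proof. exact: normal_norm (rel_lcn_normal i). Qed.

Lemma rel_lcn_sub i : rel_lcn i \subset U.
Proof. exact: normal_sub (rel_lcn_normal i). Qed.

Lemma rel_lcn_le i j : i <= j -> rel_lcn j \subset rel_lcn i.
Proof.
move=> le_ij; rewrite -(subnK le_ij); elim: (j - i) => //= m.
by apply: subset_trans; rewrite commg_subl rel_lcn_norm.
Qed.

Lemma rel_lcn_sub_lcn i : rel_lcn i \subset 'L_i.+1(U).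
Proof. by elim: i => [|i IHi]; [exact: normal_sub | apply: commSg]. Qed.

(** As for the lower central series: induction on j through the three subgroups lemma. *)
Lemma commg_rel_lcn_lcn i j : [~: rel_lcn i, 'L_j.+1(U)] \subset rel_lcn (i + j).+1.
Proof.
elim: j i => [|j IHj] i; first by rewrite addn0.
rewrite lcnSn commGC three_subgroup_mod ?(subset_trans _ (rel_lcn_norm _)) //.
- exact: rel_lcn_sub.
- exact: lcn_sub.
- by rewrite (commGC U) addnS -addSn (IHj i.+1).
by rewrite addnS (subset_trans (commSg _ (IHj i))).
Qed.

Lemma commg_rel_lcn i j : [~: rel_lcn i, rel_lcn j] \subset rel_lcn (i + j).+1.
Proof. exact: subset_trans (commgS _ (rel_lcn_sub_lcn j)) (commg_rel_lcn_lcn i j). Qed.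

Lemma Hall_Petrescu_rel (K : {group gT}) j n x y : x \in U -> y \in rel_lcn j ->
    (forall s c, 1 < s <= n -> c \in rel_lcn (j + s.-1) -> c ^+ 'C(n, s) \in K) ->
  (x ^+ n * y ^+ n)^-1 * (x * y) ^+ n \in K.
Proof.
move=> Ux Vy KC; pose J := (<[x]> <*> rel_lcn j)%G.
have sJU : J \subset U by rewrite join_subG cycle_subG Ux rel_lcn_sub.
(* Only y needs to be deep: J is generated by x and the j-th term, which is central in U modulo the
   next term, so [J, J] already lies in term j + 1. *)
pose G s := if s is s'.+2 then rel_lcn (j + s'.+1) else J.
apply: (@Hall_Petrescu _ G); rewrite ?mem_gen ?inE ?cycle_id ?Vy ?orbT //; last first.
- by case=> [|[|s]] // c; apply: KC.
- case=> [|[|i]] //=; last by apply: rel_lcn_le; rewrite leq_add2l.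
  by rewrite addn1 (subset_trans (rel_lcn_le (leqnSn _))) // joing_subr.
have JV i : [~: J, rel_lcn i] \subset rel_lcn i.+1.
  by rewrite commGC (commgS _ sJU).
have JJ : [~: J, J] \subset rel_lcn j.+1.
  have nK (A : {set gT}) : A \subset U -> A \subset 'N(rel_lcn j.+1).
    by move=> sAU; apply: subset_trans sAU (rel_lcn_norm _).
  rewrite /= -quotient_cents2 ?nK // quotientY ?nK ?rel_lcn_sub ?cycle_subG //.
  rewrite -/(abelian _) abelianY quotient_abelian ?cycle_abelian //= /abelian.
  by rewrite !quotient_cents2 ?nK ?rel_lcn_sub ?cycle_subG // !commgS ?rel_lcn_sub ?cycle_subG.
case=> [|[|i]] [|[|k]]; rewrite /= ?addn0 ?add0n ?addn1 ?commg_subr ?commg_subl ?normG //.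
- exact: subset_trans sJU (rel_lcn_norm _).
- by rewrite (addnS j k.+1); apply: JV.
- exact: subset_trans sJU (rel_lcn_norm _).
- by rewrite commGC (addnS j i.+1); apply: JV.
by apply: subset_trans (commg_rel_lcn _ _) (rel_lcn_le _); lia.
Qed.

(* Weights: a p ^ r-th power of an element of the j-th term weighs
   r * (p - 1) + j, and by pfactor_dvd_bin every Hall-Petrescu correction
   c ^+ 'C(p ^ r, s) has a representation of weight at least as large. *)
Lemma Hall_Petrescu_weight (K : {group gT}) p j r x y :
    prime p -> x \in U -> y \in rel_lcn j ->
    (forall i t c, j < i -> r * p.-1 + j <= t * p.-1 + i ->
      c \in rel_lcn i -> c ^+ (p ^ t) \in K) ->
  (x ^+ (p ^ r) * y ^+ (p ^ r))^-1 * (x * y) ^+ (p ^ r) \in K.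
Proof.
move=> p_pr Ux Vy KC; apply: Hall_Petrescu_rel Ux Vy _ => s c /andP[s_gt1 le_s] Vc.
have [|t /dvdnP[m ->] wt] := @pfactor_dvd_bin p r s p_pr; first by rewrite ltnW.
by rewrite expgM; apply: KC (groupX m Vc); lia.
Qed.

(** Hall-Petrescu for x and [x, h], whose product is x^h, gives [x^(p^r), h] = [x, h]^(p^r) modulo
    K; the case i = j of the hypothesis absorbs the right-hand side. *)
Lemma commX_mod (K : {group gT}) p j r x h :
    prime p -> x \in U -> [~ x, h] \in rel_lcn j ->
    (forall i t c, j <= i -> r * p.-1 + j <= t * p.-1 + i ->
      c \in rel_lcn i -> c ^+ (p ^ t) \in K) ->
  [~ x ^+ (p ^ r), h] \in K.
Proof.
move=> p_pr Ux Vxh KC.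
have KH := Hall_Petrescu_weight p_pr Ux Vxh (fun i t c lt_ji => KC i t c (ltnW lt_ji)).
rewrite -conjg_mulR invMg -mulgA -conjXg -commgEl in KH.
by rewrite -(mulKVg ([~ x, h] ^+ (p ^ r)) [~ _, h]) groupM // (KC j).
Qed.

(** Modulo K the p^q-th power map is multiplicative on the i-th term, so generators suffice. For a
    generator [a, h] its power is [a^(p^q), h] modulo K, and a^(p^q) is central modulo K by
    induction on i, with K varying. *)
Lemma expg_rel_lcn_mod (p k i : nat) (S : {set gT}) :
    prime p -> N :=: <<S>> -> (forall z, z \in S -> z ^+ (p ^ k) = 1) ->
  forall (K : {group gT}) q, k <= q -> U \subset 'N(K) ->
    (forall j t c, i < j -> q * p.-1 + i <= t * p.-1 + j ->
      c \in rel_lcn j -> c ^+ (p ^ t) \in K) ->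
  forall a, a \in rel_lcn i -> a ^+ (p ^ q) \in K.
Proof.
move=> p_pr defN S1.
have gen (K : {group gT}) q l (A : {set gT}) :
    (forall j t c, l < j -> q * p.-1 + l <= t * p.-1 + j ->
      c \in rel_lcn j -> c ^+ (p ^ t) \in K) -> rel_lcn l :=: <<A>> ->
    (forall a, a \in A -> a ^+ (p ^ q) \in K) ->
  forall a, a \in rel_lcn l -> a ^+ (p ^ q) \in K.
  move=> KC defV KA; pose B := [set a in rel_lcn l | a ^+ (p ^ q) \in K].
  have gB : group_set B.
    apply/group_setP; split=> [|a b]; first by rewrite inE group1 expg1n /=.
    rewrite !inE => /andP[Va Ka] /andP[Vb Kb]; rewrite groupM //=.
    rewrite -(mulKVg (a ^+ (p ^ q) * b ^+ (p ^ q)) ((a * b) ^+ _)) groupM ?(groupM Ka) //.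
    exact: (Hall_Petrescu_weight p_pr (subsetP (rel_lcn_sub l) _ Va) Vb).
  suff /subsetP sVB : rel_lcn l \subset (group gB) by move=> a /sVB; rewrite inE => /andP[].
  rewrite defV gen_subG; apply/subsetP=> a Aa.
  by rewrite !inE KA // defV mem_gen.
elim: i => [|i IHi] K q le_kq nKU KC.
  by apply: (gen K q 0 S) => // a Sa; rewrite -(subnKC le_kq) expnD expgM S1 // expg1n group1.
(* L / K is the centre of U / K, to which the induction hypothesis applies. *)
pose L := [set g in U | [set [~ g, h] | h in U] \subset K].
have LP g : reflect (g \in U /\ forall h, h \in U -> [~ g, h] \in K) (g \in L).
  rewrite inE; apply: (iffP andP) => -[Ug gK]; split=> //.
    by move=> h Uh; rewrite (subsetP gK) // imset_f.
  by apply/subsetP=> _ /imsetP[h Uh ->]; apply: gK.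
have gL : group_set L.
  apply/group_setP; split=> [|g g' /LP[Ug gK] /LP[Ug' gK']].
    by apply/LP; split=> // h Uh; rewrite comm1g.
  apply/LP; split=> [|h Uh]; first exact: groupM.
  by rewrite commMgJ groupM ?gK' // memJ_norm ?gK // (subsetP nKU).
have LN : U \subset 'N(group gL).
  apply/subsetP=> u Uu; rewrite inE; apply/subsetP=> _ /imsetP[g /LP[Ug gK] ->].
  apply/LP; split=> [|h Uh]; first exact: groupJ.
  by rewrite -[h](conjgKV u) -conjRg memJ_norm ?(subsetP nKU) // gK // groupJ ?groupV.
apply: (gen K q i.+1 (commg_set (rel_lcn i) U)) => // _ /imset2P[a h Va Uh ->].
have sVU := subsetP (rel_lcn_sub i); have Vah : [~ a, h] \in rel_lcn i.+1 by apply: mem_commg.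
have := Hall_Petrescu_weight p_pr (sVU _ Va) Vah KC.
rewrite -conjg_mulR invMg -mulgA -conjXg -commgEl.
rewrite groupMr ?groupV //.
suff /LP[_] : a ^+ (p ^ q) \in group gL by apply.
apply: (IHi _ q) => // j t c lt_ij wt Vc; apply/LP; split=> [|g Ug].
  by rewrite groupX // (subsetP (rel_lcn_sub j)).
apply: (@commX_mod K p j.+1) => //.
- by rewrite (subsetP (rel_lcn_sub j)).
- exact: mem_commg.
by move=> l s d le_jl wd Vd; apply: (KC l) => //; lia.
Qed.

End RelativeSeries.

(* Lie-theoretically [z, p ^ k * x] = [p ^ k * z, x] = 0; in a group of class c
   the exponent loses at most about c / (p - 1). *)
Lemma order_pfactor_commute (gT : finGroupType) (U : {group gT}) p c k r x z :
    prime p -> nil_class U <= c -> nilpotent U ->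
    k * p.-1 + c <= r * p.-1 + 2 -> x \in U -> z \in U -> z ^+ (p ^ k) = 1 ->
  commute z (x ^+ (p ^ r)).
Proof.
move=> p_pr clU nilU le_r Ux Uz z1.
(* N is generated by the conjugates of z, all killed by p^k. *)
pose N := <<z ^: U>>%G.
have nsNU : N <| U.
  rewrite /normal gen_subG class_subG //=; apply: norms_gen; exact: class_norm.
have Vc j : c <= j -> rel_lcn U N j :=: 1.
  move=> le_cj; apply/trivgP; apply: subset_trans (rel_lcn_sub_lcn nsNU j) _.
  apply: subset_trans (lcn_sub_leq _ (leq_trans clU le_cj : nil_class U < j.+1)) _.
  by rewrite (lcn_nil_classP _ nilU (leqnn _)).
(* Descending induction along the series, [d] bounding the distance to the trivial term c; deeper
   powers of sufficient weight are trivial, so [expg_rel_lcn_mod] applies with K = 1. *)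
have exp1 d j t a : c <= j + d -> k * p.-1 + c <= t * p.-1 + j.+1 ->
    a \in rel_lcn U N j -> a ^+ (p ^ t) = 1.
  elim/ltn_ind: d j t a => d IHd j t a le_c wt Va.
  have [le_cj | lt_jc] := leqP c j.
    by move: Va; rewrite Vc // => /set1P->; rewrite expg1n.
  apply/set1gP; apply: (@expg_rel_lcn_mod _ U N nsNU p k j (z ^: U) p_pr _ _ 1%G t) => //.
  - by move=> _ /imsetP[u Uu ->]; rewrite -conjXg z1 conj1g.
  - rewrite -(@leq_pmul2r p.-1); last by case: (p) p_pr => [|[]].
    by lia.
  - exact: norms1.
  move=> i s b lt_ji ws Vb; apply/set1gP; apply: (IHd (d - (i - j))) Vb; lia.
(* [x, z] lies in term 1, and [exp1] gains one more unit of weight: together these are the 2 in the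
   bound on r. *)
apply: commute_sym; apply/commgP/eqP/set1gP.
apply: (@commX_mod _ U N nsNU 1%G p 1) => //.
  by rewrite -invg_comm groupV mem_commg // mem_gen // class_refl.
move=> i t a i_gt0 wt Va; apply/set1gP; apply: (exp1 c i) => //; lia.
Qed.

(** * p-groups whose elements of small order are central *)

Lemma expg_pfactor_le (gT : finGroupType) (z : gT) p m n :
  m <= n -> z ^+ (p ^ m) = 1 -> z ^+ (p ^ n) = 1.
Proof. by move=> le_mn z1; rewrite -(subnKC le_mn) expnD expgM z1 expg1n. Qed.

(* Here f = g.+1, so that the exponents f - 1, f, f + 1 are g, g.+1, g.+2. *)
Section PCentral.

Variables (gT : finGroupType) (M : {group gT}) (p g : nat).
Hypotheses (p_pr : prime p) (pM : p.-group M).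
Hypothesis cM : forall z, z \in M -> z ^+ (p ^ g.+2) = 1 -> z \in 'C(M).

(** Descending induction on the term of the lower central series containing t = x^-1 y. Once w =
    [x, y] and then t are shown central, y^p = x^p t^p yields t^p = z. *)
Lemma pcentral_expg_eq x y z : x \in M -> y \in M -> z \in M ->
  y ^+ p = x ^+ p * z -> z ^+ (p ^ g) = 1 -> (x^-1 * y) ^+ (p ^ g.+1) = 1.
Proof.
have /lcnP[n Ln1] := pgroup_nil pM.
suff gen d i : n < i.+1 + d -> forall x y z, x \in M -> y \in M -> z \in M ->
    x^-1 * y \in 'L_i.+1(M) -> y ^+ p = x ^+ p * z -> z ^+ (p ^ g) = 1 ->
    (x^-1 * y) ^+ (p ^ g.+1) = 1.
  move=> Mx My Mz; apply: (gen n 0) => //;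
    by rewrite lcn1 groupM ?groupV.
elim: d i => [|d IHd] i lt_n {}x {}y {}z Mx My Mz.
  rewrite addn0 in lt_n; move/(subsetP (lcn_sub_leq _ lt_n)); rewrite Ln1 => /set1P-> _ _.
  exact: expg1n.
set t := x^-1 * y => Lt def_yp z1; have def_y : y = x * t by rewrite mulKVg.
have Mt : t \in M by rewrite groupM ?groupV.
clearbody t.
have cz : z \in 'C(M) by apply: cM => //; apply: expg_pfactor_le z1; lia.
have cC u : u \in 'C(M) -> forall v, v \in M -> commute u v by move/centP.
have cxpy : commute (x ^+ p) y.
  rewrite -(mulgK z (x ^+ p)) -def_yp; apply: commute_sym; apply: commuteM.
    exact: commuteX.
  by apply: commuteV; apply: commute_sym; apply: cC.
pose w := [~ x, y].
have Mw : w \in M by rewrite groupR.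
have cw : w \in 'C(M).
  (* w = x^-1 x^y lies one term deeper, and x^y has the same p-th power as x because y commutes with
     x^p; induction applies with z = 1. *)
  apply: cM => //; apply: (@expg_pfactor_le _ _ _ g.+1) => //.
  rewrite /w commgEl; apply: (IHd i.+1 _ _ _ 1); rewrite ?groupJ ?expg1n ?mulg1 //.
  - by rewrite addSnnS.
  - rewrite -commgEl def_y commgMJ commgg conj1g mulg1.
    by rewrite lcnSn commGC mem_commg.
  - by rewrite -conjXg; apply/conjg_fixP/commgP.
have wp : w ^+ p = 1.
  by rewrite -commXg; [apply/eqP/commgP | apply: commute_sym; apply: cC].
have def_tp : t ^+ p * w^-1 ^+ 'C(p, 2) = z.
  have tx : [~ t, x] = w^-1.
    by rewrite /w invg_comm def_y commMgJ commgg conj1g mul1g.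
  apply: (mulgI (x ^+ p)); rewrite -def_yp def_y mulgA -tx.
  by apply/esym/expMg_Rmul; apply: commute_sym; apply: cC; rewrite ?tx ?groupV.
(* So far t^p is z times a power of w, which only shows that p^(g+2) kills t; this is why [cM]
   reaches g + 2. *)
have ct : t \in 'C(M).
  apply: cM => //; rewrite expnS expgM -(mulgK (w^-1 ^+ 'C(p, 2)) (t ^+ p)) def_tp.
  rewrite expgMn; last by apply: cC => //; rewrite groupV groupX ?groupV.
  rewrite (@expg_pfactor_le _ _ _ g) // mul1g -expgVn invgK -expgM mulnC expnS -mulnA expgM.
  by rewrite wp expg1n.
rewrite expnS expgM; suff -> : t ^+ p = z by [].
apply: (mulgI (x ^+ p)); rewrite -def_yp def_y expgMn //.
by apply: commute_sym; apply: cC.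
Qed.

Lemma card_pcentral_Ohm (rT : finGroupType) (theta : {morphism M >-> rT}) :
    (forall x, x \in M -> theta (x ^+ p) = 1) ->
    (forall x, x \in M -> x ^+ (p ^ g) = 1 -> theta x = 1) ->
  #|theta @* M| * #|'Ohm_g('Z(M))| <= #|'Ohm_g.+1('Z(M))|.
Proof.
move=> theta_p theta_g; pose Z := 'Z(M)%G.
have pZ : p.-group Z := pgroupS (center_sub M) pM.
have OhmZ n : 'Ohm_n(Z) = 'Ldiv_(p ^ n)(Z).
  by rewrite (OhmEabelian pZ) // (abelianS (Ohm_sub n Z)) ?center_abelian.
rewrite -(leq_pmul2l (cardG_gt0 ('ker theta))) mulnA card_morphim setIid.
rewrite Lagrange ?subsetIl // -!cardsX !OhmZ.
set B := 'Ldiv_(_)(_); set A := 'Ldiv_(_)(_).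
have inL n z : z \in 'Ldiv_(p ^ n)(Z) -> z \in Z /\ z ^+ (p ^ n) = 1.
  by move/LdivP.
have inZ z : z \in Z -> z \in M /\ z \in 'C(M) by move/setIP.
(* The map (x, b) |-> x ^+ p * b from M x Ohm_g(Z) to the kernel of theta has
   fibres of size at most |Ohm_(g+1)(Z)|. *)
pose mul u : gT := u.1 ^+ p * u.2.
pose base k := odflt (1, 1) [pick u in setX M B | mul u == k].
have baseP u : u \in setX M B -> base (mul u) \in setX M B /\ mul (base (mul u)) = mul u.
  move=> Wu; rewrite /base; case: pickP => [v /andP[Wv /eqP] | /(_ u)] //.
  by rewrite Wu eqxx.
(* [base] selects one point in each fibre, its default (1, 1) never being used on values of [mul].
   The displacement from that point is killed by p^(g+1), by [pcentral_expg_eq], hence central. *)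
pose pair u := (mul u, (base (mul u)).1^-1 * u.1).
rewrite -(card_in_imset (f := pair) (D := mem (setX M B))); last first.
  move=> [x b] [y c] _ _ [eq_mul]; rewrite -eq_mul => /mulgI /= eq_xy.
  by move: eq_mul; rewrite /mul /= eq_xy => /mulgI->.
apply: subset_leq_card; apply/subsetP=> _ /imsetP[[x b] Wxb ->].
have [] := baseP _ Wxb; move: Wxb; rewrite /pair; set k := mul _.
case: (base k) => y c; rewrite !in_setX /= => /andP[Mx /inL[/inZ[Mb cb] b1]].
move=> /andP[My /inL[/inZ[Mc cc] c1]] def_k.
have Mk : k \in M by rewrite groupM ?groupX.
rewrite !inE Mk /= morphM ?groupX // theta_p // theta_g // mulg1 eqxx /=.
have eqp : x ^+ p = y ^+ p * (c * b^-1).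
  by rewrite mulgA -[y ^+ p * c]/(mul (y, c)) def_k mulgK.
have cbb : (c * b^-1) ^+ (p ^ g) = 1.
  rewrite expgMn ?c1 ?expgVn ?b1 ?invg1 ?mulg1 //.
  by apply/commuteV/commute_sym/(centP cb).
have yx1 : (y^-1 * x) ^+ (p ^ g.+1) = 1.
  by apply: pcentral_expg_eq eqp cbb; rewrite ?groupM ?groupV.
rewrite yx1 eqxx andbT groupM ?groupV //=.
by apply: cM; rewrite ?groupM ?groupV // (expg_pfactor_le _ yx1).
Qed.

End PCentral.

(** * Homocyclic subgroups of abelian p-groups *)

Lemma abelian_Ohm_Cpow (gT : finGroupType) (Z : {group gT}) p g d :
    prime p -> p.-group Z -> abelian Z ->
    p ^ d * #|'Ohm_g(Z)| <= #|'Ohm_g.+1(Z)| ->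
  exists2 H : {group gT}, H \subset Z & H \isog Cpow (p ^ g.+1)%N d.
Proof.
move=> p_pr pZ cZZ le_card; have p_gt1 := prime_gt1 p_pr.
have [b defZ _] := abelian_structure cZZ.
(* The index of Ohm_g in Ohm_(g+1) is p to the number of cyclic factors of order at least p^(g+1); d
   of these are kept, and [t i] below generates the subgroup of order p^(g+1) in the i-th. *)
have: d <= count [pred x | logn p #[x] > g] b.
  rewrite (count_logn_dprod_cycle _ _ defZ) -(leq_exp2l _ _ p_gt1) -p_part part_pnat_id.
    by rewrite -(leq_pmul2r (cardG_gt0 'Ohm_g(Z))) mulnC [leqRHS]mulnC Lagrange 1?mulnC ?Ohm_leq.
  exact: pnat_dvd (dvdn_indexg _ _) (pgroupS (Ohm_sub _ _) pZ).
rewrite -size_filter; set b1 := filter _ b => le_d.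
have b1_order : {in b1, forall x, p ^ g.+1 %| #[x]}.
  by move=> x; rewrite mem_filter /= => /andP[lt_g _]; rewrite pfactor_dvdn.
have defb : \big[dprod/1]_(x <- b1) <[x]> \x
    \big[dprod/1]_(x <- b | ~~ (logn p #[x] > g)) <[x]> = Z.
  by rewrite big_filter -[RHS]defZ [RHS](bigID (fun x => g < logn p #[x])).
have [[G1 G1' defG1 defG1'] mulG1 _ _] := dprodP defb.
have: \big[dprod/1]_(x <- b1) <[x]> = G1 by [].
rewrite -{1}(cat_take_drop d b1) big_cat => /dprodP[[G2 G2' defG2 defG2'] mulG2 _ _].
have szb2 : size (take d b1) = d by rewrite size_takel.
have sG2Z : G2 \subset Z.
  rewrite -mulG1 defG1 -mulG2 defG1' defG2 defG2'.
  exact: subset_trans (mulG_subl _ _) (mulG_subl _ _).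
pose y (i : 'I_d) := (take d b1)`_i.
have {}defG2 : \big[dprod/1]_(i < d) <[y i]> = G2.
  by rewrite -defG2 (big_nth 1) szb2 big_mkord.
have yord i : p ^ g.+1 %| #[y i].
  by apply/b1_order/(@mem_take d)/mem_nth; rewrite szb2.
pose k := (p ^ g.+1)%N; pose t i := y i ^+ (#[y i] %/ k).
have k_gt1 : 1 < k by rewrite -(exp1n g.+1) ltn_exp2r.
have tord i : #[t i] = k.
  by rewrite orderXdiv ?dvdn_div ?yord // divnA ?dvdn_div ?yord // mulKn ?order_gt0.
have yG2 i : y i \in G2.
  by rewrite -(bigdprodWY defG2) mem_gen //; apply/bigcupP; exists i; rewrite ?cycle_id.
have tZ i : t i \in Z by rewrite groupX // (subsetP sG2Z).
pose h (u : {dffun forall _ : 'I_d, 'Z_k}) := \prod_i t i ^+ (u i).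
have hM : {in Cpow k d &, {morph h : u v / u * v}}.
  move=> u v _ _; rewrite /h.
  have prodM (F G : 'I_d -> gT) : (forall i, F i \in Z) -> (forall i, G i \in Z) ->
      \prod_i (F i * G i) = \prod_i F i * \prod_i G i.
    move=> ZF ZG; elim: (index_enum _) => [|i r IHr]; first by rewrite !big_nil mulg1.
    rewrite !big_cons IHr -!mulgA; congr (_ * _); rewrite !mulgA; congr (_ * _).
    by apply: (centsP cZZ) => //; apply: group_prod.
  rewrite -prodM; try by move=> i; apply: groupX (tZ i).
  apply: eq_bigr => i _; rewrite -expgD -[in RHS](expg_mod_order (t i)) tord.
  by rewrite dffunM /= [in LHS](congr1 (modn _) (Zp_cast k_gt1)).
pose hm := Morphism hM.
have injh : 'injm hm.
  apply/subsetP=> u /morphpreP[Cu /set1P hu1]; apply/set1P.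
  have [c [_ _ c_uniq]] := mem_bigdprod defG2 (group1 G2).
  have c1 i : c i = 1.
    by apply/esym/(c_uniq (fun=> 1)) => //; rewrite big1.
  apply/ffunP=> i; rewrite ffunE; apply/val_inj/eqP.
  have: t i ^+ u i == 1.
    by rewrite -(c1 i) (c_uniq (fun i => t i ^+ u i)) // => j _; rewrite !groupX ?cycle_id.
  rewrite -order_dvdn tord /= => k_dvd_u; apply: contraLR k_dvd_u.
  by rewrite -lt0n => /gtnNdvd-> //; rewrite -[ltnRHS](Zp_cast k_gt1) ltn_ord.
exists (hm @* Cpow k d)%G; last by rewrite isog_sym sub_isog.
apply/subsetP=> _ /morphimP[u _ _ ->]; apply: group_prod => i _.
exact: groupX (tZ i).
Qed.

(** * The exponent e, and powers in [Cpow] *)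

Lemma leq_expn_ceil_logb (R : realType) (p c d e : nat) : (1 < p)%N -> (0 < d)%N ->
  (e%:Z = Num.ceil (c%:R * logb (p%:R : R) (d%:R : R)))%R -> (d ^ c <= p ^ e)%N.
Proof.
move=> p_gt1 d_gt0 def_e.
have: (c%:R * logb (p%:R : R) d%:R <= e%:R :> R)%R.
  by rewrite -[leRHS]/((e%:Z)%:~R)%R -Num.Theory.ceil_le_int -def_e.
have p_gt0 : (0 < p%:R :> R)%R by rewrite Num.Theory.ltr0n ltnW.
have d_gt0R : (0 < d%:R :> R)%R by rewrite Num.Theory.ltr0n.
have lnp_gt0 : (0 < ln (p%:R : R))%R by rewrite ln_gt0 // Num.Theory.ltr1n.
rewrite /logb GRing.mulrA Num.Theory.ler_pdivrMr // !GRing.mulr_natl -!lnXn //.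
by rewrite ler_ln ?Num.Theory.posrE ?Num.Theory.exprn_gt0 // -!GRing.natrX Num.Theory.ler_nat.
Qed.

Section Cpow.

Variables (k d : nat).
Hypothesis k_gt1 : 1 < k.
Implicit Types u v : {dffun forall _ : 'I_d, 'Z_k}.

Lemma mem_Cpow u : u \in Cpow k d.
Proof. by apply/setXnP => i; rewrite /= /Zp k_gt1 inE. Qed.

Lemma expg_dffunE u n i : (u ^+ n) i = u i ^+ n.
Proof. by elim: n => [|n IHn]; rewrite ?expg0 ?ffunE // !expgS dffunM IHn. Qed.

Lemma Cpow_abelian : abelian (Cpow k d).
Proof.
apply/centsP=> u _ v _; apply/ffunP=> i; rewrite !dffunM.
by apply: (centsP (Zp_abelian _)); rewrite inE.
Qed.

Lemma expg_Cpow u : u ^+ k = 1.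
Proof.
apply/ffunP=> i; rewrite expg_dffunE ffunE Zp_expg; apply: val_inj.
by rewrite /= [LHS](congr1 (modn _) (Zp_cast k_gt1)) modnMl.
Qed.
End Cpow.

Lemma Cpow1_cyclic k : 1 < k -> cyclic (Cpow k 1).
Proof.
move=> k_gt1; pose x : {dffun forall _ : 'I_1, 'Z_k} := [ffun=> inZp 1].
apply/cyclicP; exists x; apply/eqP; rewrite eqEsubset cycle_subG mem_Cpow // andbT.
apply/subsetP=> u _; suff -> : u = x ^+ u ord0 by apply: mem_cycle.
apply/ffunP=> i; rewrite expg_dffunE !ffunE Zp_expg (ord1 i); apply: val_inj => /=.
by rewrite modnMml mul1n modn_small.
Qed.

Lemma card_expg_Cpow p n d : 1 < p ->
  p ^ d <= #|[set u ^+ (p ^ n) | u in Cpow (p ^ n.+1)%N d]|.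
Proof.
move=> p_gt1; pose k := (p ^ n.+1)%N.
have k_gt1 : 1 < k by rewrite -(exp1n n.+1) ltn_exp2r.
(* Vectors with digits below p: multiplying a digit by p^n modulo p^(n+1) loses nothing. *)
pose F (a : {ffun 'I_d -> 'I_p}) : {dffun forall _ : 'I_d, 'Z_k} := [ffun i => inZp (a i)].
have injF : injective (fun a => F a ^+ (p ^ n)).
  move=> a b /ffunP eqF; apply/ffunP=> i; apply: val_inj.
  have := congr1 val (eqF i).
  rewrite !expg_dffunE !ffunE !Zp_expg /= !modnMml.
  rewrite [RHS](congr1 (modn _) (Zp_cast k_gt1)) [LHS](congr1 (modn _) (Zp_cast k_gt1)).
  rewrite /k expnS -!muln_modl !modn_small // => /eqP.
  by rewrite eqn_pmul2r ?expn_gt0 ?(ltnW p_gt1) // => /eqP.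
rewrite -[leqLHS](_ : #|[set F a ^+ (p ^ n) | a in {ffun 'I_d -> 'I_p}]| = _).
  apply/subset_leq_card/subsetP=> _ /imsetP[a _ ->].
  by apply/imsetP; exists (F a); rewrite ?mem_Cpow.
by rewrite card_imset // card_ffun !card_ord.
Qed.

(** * Construction of the homocyclic subgroup *)

Section HomocyclicSubgroup.

Variables (gT : finGroupType) (p g d : nat).
Hypothesis p_pr : prime p.

(** The map x |-> phi(x)^(p^g) on M kills p-th powers and elements of order dividing p^g, so the
    size of its image bounds the index of Ohm_g in Ohm_(g+1) for Z(M). *)
Lemma pcentral_Cpow (rT : finGroupType) (U M : {group gT}) (phi : {morphism U >-> rT}) :
    p.-group M -> M \subset U -> abelian (phi @* U) ->
    (forall z, z \in M -> z ^+ (p ^ g.+2) = 1 -> z \in 'C(M)) ->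
    (forall x, x \in M -> phi x ^+ (p ^ g.+1) = 1) ->
    p ^ d <= #|[set phi x ^+ (p ^ g) | x in M]| ->
  exists2 H : {group gT}, H \subset M & H \isog Cpow (p ^ g.+1)%N d.
Proof.
move=> pM sMU cphi cM phi1 le_d; have sMUP := subsetP sMU.
pose theta x := phi x ^+ (p ^ g).
have thetaM : {in M &, {morph theta : x y / x * y}}.
  move=> x y Mx My; rewrite /theta morphM ?sMUP // expgMn //.
  by apply: (centsP cphi); rewrite mem_morphim ?sMUP.
have pZ : p.-group 'Z(M) := pgroupS (center_sub M) pM.
case: (@abelian_Ohm_Cpow _ 'Z(M)%G p g d p_pr pZ (center_abelian M)); last first.
  by move=> H sHZ isoH; exists H => //; apply: subset_trans sHZ (center_sub M).
apply: leq_trans (card_pcentral_Ohm p_pr pM cM (theta := Morphism thetaM) _ _).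
- rewrite leq_mul2r (leq_trans le_d) ?orbT //; apply/subset_leq_card/subsetP.
  by move=> _ /imsetP[x Mx ->]; apply: (mem_morphim (Morphism thetaM)).
- by move=> x Mx; rewrite /= /theta morphX ?sMUP // -expgM -expnS phi1.
by move=> x Mx x1; rewrite /= /theta -morphX ?sMUP // x1 morph1.
Qed.

(** Take M generated by the p^n-th powers of U: its image consists of the p^n-th powers in [Cpow],
    and an element commuting with all generators centralises M. *)
Lemma commuting_powers_Cpow (U : {group gT}) n
    (phi : {morphism U >-> {dffun forall _ : 'I_d, 'Z_(p ^ (n + g).+1)%N}}) :
    p.-group U -> phi @* U = Cpow (p ^ (n + g).+1)%N d ->
    (forall x z, x \in U -> z \in U -> z ^+ (p ^ g.+2) = 1 -> commute z (x ^+ (p ^ n))) ->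
  exists2 H : {group gT}, H \subset U & H \isog Cpow (p ^ g.+1)%N d.
Proof.
move=> pU im_phi commU; pose k := (p ^ (n + g).+1)%N.
have k_gt1 : 1 < k by rewrite -(exp1n (n + g).+1) ltn_exp2r // prime_gt1.
have cphi : abelian (phi @* U) by rewrite im_phi Cpow_abelian.
have sMU := Mho_sub n U; have pM := pgroupS sMU pU.
have imM : phi @* 'Mho^n(U) = [set u ^+ (p ^ n) | u in Cpow k d].
  rewrite morphim_Mho // im_phi -(@MhoEabelian n _ p) // -?im_phi //.
  exact: morphim_pgroup.
case: (@pcentral_Cpow _ U 'Mho^n(U)%G phi pM sMU cphi); last first.
- by move=> H sHM isoH; exists H => //; apply: subset_trans sHM sMU.
- apply: leq_trans (@card_expg_Cpow p (n + g) d (prime_gt1 p_pr)) _.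
  apply/subset_leq_card/subsetP=> _ /imsetP[u Cu ->].
  have /morphimP[x Ux _ def_u] : u \in phi @* U by rewrite im_phi.
  apply/imsetP; exists (x ^+ (p ^ n)); first exact: Mho_p_elt (mem_p_elt pU Ux).
  by rewrite morphX // -def_u -expgM -expnD.
- move=> x Mx; have: phi x \in phi @* 'Mho^n(U) by rewrite mem_morphim // (subsetP sMU).
  by rewrite imM => /imsetP[u _ ->]; rewrite -expgM -expnD addnS expg_Cpow.
move=> z Mz z1; have Uz := subsetP sMU z Mz.
rewrite -sub_cent1 /= (MhoE n pU) gen_subG; apply/subsetP=> _ /imsetP[x Ux ->].
by apply/cent1P/esym/commU.
Qed.

End HomocyclicSubgroup.

Theorem theorem3p2 (R : realType) (p c d f e : nat)
    (gT : finGroupType) (U : {group gT})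
    (p_prime : prime p) (c_ge1 : (1 <= c)%N) (d_ge1 : (1 <= d)%N)
    (f_ge1 : (1 <= f)%N)
    (U_pgroup : p.-group U) (U_class : (nil_class U <= c)%N)
    (e_def : (e%:Z = Num.ceil (c%:R * logb (p%:R : R) (d%:R : R)))%R)
    (U_surj : exists phi : {morphism U >-> {dffun forall _ : 'I_d, 'Z_(p ^ (2 * f + e + 1))%N}},
        phi @* U = Cpow (p ^ (2 * f + e + 1))%N d) :
  exists2 H : {group gT}, H \subset U & H \isog Cpow (p ^ f)%N d.
Proof.
have p_gt1 := prime_gt1 p_prime.
have le_dc := leq_expn_ceil_logb p_gt1 d_ge1 e_def.
case: U_surj => phi im_phi; case: f f_ge1 phi im_phi => // g _ phi im_phi.
have def_n : 2 * g.+1 + e + 1 = (g.+2 + e + g).+1 by lia.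
move: phi im_phi; rewrite {}def_n => phi im_phi.
have [d_gt1 | d_le1] := ltnP 1 d.
  apply: commuting_powers_Cpow im_phi _ => // x z Ux Uz.
  apply: (@order_pfactor_commute _ U p c) => //; first exact: pgroup_nil U_pgroup.
  (* 2^c <= d^c <= p^e <= 2^(e (p - 1)). *)
  have le_c : c <= e * p.-1.
    rewrite -(leq_exp2l _ _ (ltnSn 1)); apply: (@leq_trans (d ^ c)).
      by rewrite leq_exp2r.
    apply: leq_trans le_dc _; rewrite mulnC expnM.
    have [-> // | e_gt0] := posnP e.
    by rewrite leq_exp2r // -{1}(prednK (ltnW p_gt1)) ltn_expl.
  by rewrite mulnDl; lia.
have d1 : d = 1%N by lia.
subst d; set k := (p ^ _)%N in phi im_phi.
have k_gt1 : 1 < k by rewrite -(exp1n (g.+2 + e + g).+1) ltn_exp2r.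
(* For d = 1 the inequality d^c <= p^e says nothing about c. The cyclic group generated by a
   preimage of a generator still maps onto [Cpow], and its powers commute. *)
have /cyclicP[v def_C] := Cpow1_cyclic k_gt1.
have /morphimP[u Uu _ def_v] : v \in phi @* U by rewrite im_phi def_C cycle_id.
have sVU : <[u]> \subset U by rewrite cycle_subG.
case: (@commuting_powers_Cpow gT p g 1 p_prime <[u]>%G (g.+2 + e) (restrm_morphism sVU phi)).
- exact: pgroupS U_pgroup.
- by rewrite im_restrm morphim_cycle // -def_v -def_C.
- move=> x z Vx Vz _; apply: commuteX.
  exact: (centsP (cycle_abelian u)).
by move=> H sHV isoH; exists H => //; apply: subset_trans sHV sVU.
Qed.
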